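(* Let $\varepsilon>0$ be a constant. For $p=p(n)\le n^{-2/3-\varepsilon}$, a random graph $G\sim G_{n,p}$ asymptotically almost surely (i.e. with probability tending to $1$ as $n\to\infty$) has the following property: playing a $(2:2)$ Connector-Breaker game on the edge set of $G$, Breaker has a strategy to keep a vertex of $G$ isolated in Connector's graph (i.e. throughout the game some vertex is incident to no edge claimed by Connector).
   Context: $G_{n,p}$ is the binomial random graph on $n$ vertices in which each edge is present independently with probability $p$. In the $(2:2)$ Connector-Breaker game on a graph $G$, the two players alternately take turns, Connector moving first; in each turn a player claims up to two previously unclaimed edges of $G$, with the restriction that Connector must choose her edges so that the graph formed by her claimed edges is connected throughout the game. *)

(* Defs.v *)
From mathcomp Require Import all_boot all_order all_algebra.
From mathcomp Require Import boolp reals.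
Set Implicit Arguments.
Unset Strict Implicit.
Unset Printing Implicit Defensive.
Import GRing.Theory.

(* A graph on the vertex set T is identified with its set of edges, each edge
   being a two-element subset of T. *)
Definition complete_graph (T : finType) : {set {set T}} :=
  [set e : {set T} | #|e| == 2].

(* The vertices of the graph formed by the edge set C are the endpoints of its
   edges; in particular the empty edge set is connected. *)
Definition connected_edges (T : finType) (C : {set {set T}}) : Prop :=
  forall u v : T, u \in cover C -> v \in cover C ->
    connect [rel x y | [set x; y] \in C] u v.

(* A play is a pair of sequences: in round k, Connector first claims c k, and
   Breaker then claims b k.  Claiming no edge is allowed, so every play may be
   taken infinite, all moves being empty once no edge is left. *)
Definition claimed_before (T : finType) (c b : nat -> {set {set T}})
    (k : nat) : {set {set T}} :=
  \bigcup_(i < k) (c i :|: b i).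

Definition connector_legal (T : finType) (m : nat) (G : {set {set T}})
    (c b : nat -> {set {set T}}) : Prop :=
  forall k : nat,
    [/\ #|c k| <= m,
        c k \subset G :\: claimed_before c b k
      & connected_edges (\bigcup_(i < k.+1) c i)].

Definition breaker_legal (T : finType) (q : nat) (G : {set {set T}})
    (c b : nat -> {set {set T}}) : Prop :=
  forall k : nat,
    #|b k| <= q /\ b k \subset G :\: (claimed_before c b k :|: c k).

(* In the (m : q) Connector-Breaker game on G, a strategy of Breaker maps the
   list of all moves made so far by Connector to Breaker's reply (his own
   earlier moves are determined by the strategy). *)
Definition breaker_can_isolate (T : finType) (m q : nat)
    (G : {set {set T}}) : Prop :=
  exists S : seq {set {set T}} -> {set {set T}},
    forall c : nat -> {set {set T}},
      let b := fun k => S (mkseq c k.+1) in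
      connector_legal m G c b ->
      breaker_legal q G c b /\
      exists v : T, forall k : nat, v \notin cover (c k).

Local Open Scope ring_scope.

(* The probability that G_{n,p} satisfies P. *)
Definition Gnp_prob (R : realType) (n : nat) (p : R)
    (P : {set {set 'I_n}} -> Prop) : R :=
  \sum_(G in powerset (complete_graph 'I_n) | `[< P G >])
    \prod_(e in complete_graph 'I_n) (if e \in G then p else 1 - p).

(* Main.v *)
Require Import Defs.
From mathcomp Require Import all_boot all_order all_algebra zify.
From mathcomp Require Import boolp reals.
Set Implicit Arguments.
Unset Strict Implicit.
Unset Printing Implicit Defensive.

(** Why Breaker wins.

    Fix k with 1/(3k) <= eps.  A set R of constantly many vertices is chosen
    before the graph is looked at.  By a first-moment computation, with
    probability tending to 1 every bounded set U of vertices satisfies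
      (2k+1) e(U) <= 3k |U \ R|,
    where e(U) counts the edges inside U: a violation with w = |U \ R| and m
    edges has probability at most n^w p^m <= n^(-1/(3k)) up to a constant
    ([Gnp_not_sparse_le]).  Everything else is deterministic and rests on the
    deficit 3 |U \ R| - 2 e(U).  It is nonnegative on bounded sets, positive
    as soon as U contains a vertex outside R, submodular in U, and a bounded
    deficit forces a bounded number of edges; so the sets met in the proof,
    although they are built by unions, never grow beyond a fixed size.

    For a root v in R, let D grow from the closed neighbourhood of v by adding,
    as long as possible, a vertex with at least two neighbours in D.  Every
    vertex of D other than v lies in a bounded set of deficit at most 1 that
    contains v.  By submodularity a vertex with three neighbours in D, or an
    edge between two neighbours of v, would create a bounded set of deficit at
    most 0.  So each vertex was added with exactly two neighbours in D;
    directing the edges from it to those two, and the edges at v towards v,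
    gives an orientation of all edges that touch D in which vertices of D have
    at most two out-edges, neighbours of v a single one, and vertices outside D
    at most one, because D could not be extended ([exists_guard]).

    Breaker's strategy is to claim all out-edges of the vertices that Connector
    has just reached.  Since earlier vertices have no free out-edge, an edge
    along which Connector enters D is itself an out-edge of the vertex she
    reaches, which leaves at most one further out-edge there.  A short case
    analysis on the at most two new vertices, where the connectivity of
    Connector's graph is used, shows that two edges always suffice and that v
    is never reached ([card_response], [root_not_new]).

    It remains to have no out-edges at the at most four vertices of Connector's
    first move.  Each of these conditions spoils only boundedly many roots:
    uniting the bounded sets that link the spoiled roots to the first move
    never increases the deficit above 12, whereas each root contributes a new
    edge ([exists_far_guard]).  Since R is large enough, some root remains. *)

(** * Counting the edges inside a set of vertices *)

Definition edges_in (T : finType) (G : {set {set T}}) (U : {set T}) :=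
  [set e in G | e \subset U].

Definition nbrs (T : finType) (G : {set {set T}}) (x : T) :=
  [set y | [set x; y] \in G].

Lemma cardsU_disjoint (T : finType) (A B : {set T}) :
  [disjoint A & B] -> #|A :|: B| = #|A| + #|B|.
Proof. by rewrite -setI_eq0 => /eqP AB; rewrite cardsU AB cards0 subn0. Qed.

(** The edges in X run between A and B without lying inside either of them;
    they are the gain in the supermodularity of the number of edges. *)
Lemma edges_in_supermodular (T : finType) (G : {set {set T}}) (A B : {set T})
    (X : {set {set T}}) :
    X \subset edges_in G (A :|: B) ->
    (forall e, e \in X -> ~~ (e \subset A) && ~~ (e \subset B)) ->
  #|edges_in G A| + #|edges_in G B| + #|X|
    <= #|edges_in G (A :|: B)| + #|edges_in G (A :&: B)|.
Proof.
move=> sX nX.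
have -> : edges_in G (A :&: B) = edges_in G A :&: edges_in G B.
  by apply/setP=> e; rewrite !inE subsetI; case: (e \in G).
have sAB : edges_in G A :|: edges_in G B \subset edges_in G (A :|: B).
  apply/subsetP=> e; rewrite !inE => /orP[]/andP[-> /=] /subset_trans; apply.
    exact: subsetUl.
  exact: subsetUr.
have dX : #|(edges_in G A :|: edges_in G B) :|: X|
          = #|edges_in G A :|: edges_in G B| + #|X|.
  apply: cardsU_disjoint; rewrite -setI_eq0.
  apply/eqP/setP=> e; rewrite !inE; apply/negbTE/negP=> /andP[+ /nX].
  by case: (e \subset A) (e \subset B) (e \in G) => [] [] [].
have le1 : #|(edges_in G A :|: edges_in G B) :|: X|
           <= #|edges_in G (A :|: B)|.
  by apply: subset_leq_card; rewrite subUset sAB.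
have := cardsUI (edges_in G A) (edges_in G B); lia.
Qed.

Lemma edges_in_add_vertex (T : finType) (G : {set {set T}}) (U Y : {set T})
    (z : T) :
    z \notin U -> Y \subset U :&: nbrs G z ->
  #|edges_in G U| + #|Y| <= #|edges_in G (z |: U)|.
Proof.
move=> zU /subsetP sY.
have cX : #|[set [set z; y] | y in Y]| = #|Y|.
  apply: card_in_imset => y y' yY y'Y /setP/(_ y).
  have yz : y != z.
    by have:= sY _ yY; rewrite inE => /andP[yU _]; apply: contraNneq zU => <-.
  by rewrite !inE eqxx orbT (negPf yz) /= => /esym/eqP.
rewrite -cX -cardsU_disjoint.
  apply: subset_leq_card; rewrite subUset; apply/andP; split.
    apply/subsetP=> e; rewrite !inE => /andP[-> /=] /subset_trans; apply.
    exact: subsetUr.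
  apply/subsetP=> _ /imsetP[y /sY + ->]; rewrite !inE => /andP[yU ->] /=.
  by apply/subsetP=> w; rewrite !inE => /orP[/eqP->|/eqP->]; rewrite ?eqxx ?yU ?orbT.
rewrite -setI_eq0; apply/eqP/setP=> e; rewrite !inE; apply/negbTE/negP.
move=> /andP[/andP[_ /subsetP eU]] /imsetP[y _ ee].
by move: zU; rewrite eU // ee !inE eqxx.
Qed.

Corollary edges_in_setU (T : finType) (G : {set {set T}}) (A B : {set T}) :
  #|edges_in G A| + #|edges_in G B|
    <= #|edges_in G (A :|: B)| + #|edges_in G (A :&: B)|.
Proof.
have := @edges_in_supermodular _ G A B set0 (sub0set _).
by rewrite cards0 addn0; apply=> e; rewrite inE.
Qed.

Lemma edges_in_linked (T : finType) (G : {set {set T}}) (A B : {set T}) x y :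
    G \subset complete_graph T -> A :&: B = set0 -> x \in A -> y \in B ->
    [set x; y] \in G ->
  #|edges_in G A| + #|edges_in G B| + 1 <= #|edges_in G (A :|: B)|.
Proof.
move=> GK AB0 xA yB xy.
have xB : x \notin B.
  by apply/negP=> xB; suff: x \in A :&: B; [rewrite AB0 inE | rewrite inE xA].
have yA : y \notin A.
  by apply/negP=> yA; suff: y \in A :&: B; [rewrite AB0 inE | rewrite inE yA].
have := @edges_in_supermodular _ G A B [set [set x; y]].
have -> : edges_in G (A :&: B) = set0.
  rewrite AB0; apply/setP=> e; rewrite !inE subset0.
  apply/negbTE/negP=> /andP[eG /eqP e0].
  by have := subsetP GK _ eG; rewrite inE e0 cards0.
rewrite cards0 cards1 addn0; apply.
  rewrite sub1set inE xy; apply/subsetP=> z.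
  by rewrite !inE => /orP[]/eqP->; rewrite ?xA ?yB ?orbT.
move=> e; rewrite inE => /eqP->; apply/andP; split.
  by apply: contra yA => /subsetP; apply; rewrite !inE eqxx orbT.
by apply: contra xB => /subsetP; apply; rewrite !inE eqxx.
Qed.

(** * Sparse graphs and deficits *)

(** The inequality is the integer form of
    [(2/3 + 1/(3k)) e(U) <= |U \ R|]. *)
Definition sparse (T : finType) (k L : nat) (R : {set T})
    (G : {set {set T}}) : Prop :=
  forall U : {set T}, #|U| <= L ->
    (2 * k).+1 * #|edges_in G U| <= 3 * k * #|U :\: R|.

(** A tight set certifies with boundedly many edges that its vertices belong to
    the region of danger around the root v: its deficit is at most 1.  The edge
    at v is what makes tight sets of different roots contribute different
    edges. *)
Definition tight (T : finType) (k : nat) (R : {set T}) (G : {set {set T}})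
    (v : T) (U : {set T}) : Prop :=
  [/\ #|U| <= k.+1, U :&: R = [set v],
      exists2 x, x \in U & [set v; x] \in G
    & 3 * #|U :\: R| <= 2 * #|edges_in G U| + 1].

(** Bounded deficit means boundedly many edges: the slack [e(U)/k] in the
    sparsity condition is at most the deficit. *)
Lemma sparse_edges_le (T : finType) k L (R : {set T}) G (U : {set T}) c :
    sparse k L R G -> #|U| <= L ->
    3 * #|U :\: R| <= 2 * #|edges_in G U| + c ->
  #|edges_in G U| <= k * c.
Proof. by move=> spG /spG; nia. Qed.

Lemma sparse_edges_lt (T : finType) k L (R : {set T}) G (U : {set T}) :
    sparse k L R G -> #|U| <= L -> 0 < #|U :\: R| ->
  2 * #|edges_in G U| < 3 * #|U :\: R|.
Proof. by move=> spG /spG; nia. Qed.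

Lemma sparse_edges_le0 (T : finType) k L (R : {set T}) G (U : {set T}) :
    sparse k L R G -> #|U| <= L ->
  2 * #|edges_in G U| <= 3 * #|U :\: R|.
Proof. by move=> spG /spG; nia. Qed.

(** Deficits are subadditive, since the deficit of the intersection is
    nonnegative. *)
Lemma deficit_setU (T : finType) k L (R : {set T}) G (A B : {set T}) a b :
    sparse k L R G -> #|B| <= L ->
    3 * #|A :\: R| <= 2 * #|edges_in G A| + a ->
    3 * #|B :\: R| <= 2 * #|edges_in G B| + b ->
  3 * #|(A :|: B) :\: R| <= 2 * #|edges_in G (A :|: B)| + (a + b).
Proof.
move=> spG leB hA hB.
have leI : #|A :&: B| <= L by apply: leq_trans leB; rewrite subset_leq_card ?subsetIr.
have := sparse_edges_le0 spG leI.
have := edges_in_setU G A B.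
have := cardsUI (A :\: R) (B :\: R); rewrite -setDUl -setDIl; lia.
Qed.

Lemma deficit_add_vertex (T : finType) (R : {set T}) G (A Y : {set T}) z a :
    z \notin A -> Y \subset A :&: nbrs G z ->
    3 * #|A :\: R| <= 2 * #|edges_in G A| + a ->
  3 * #|(z |: A) :\: R| + 2 * #|Y|
    <= 2 * #|edges_in G (z |: A)| + (a + 3 * (z \notin R)).
Proof.
move=> zA /(edges_in_add_vertex zA) sm hA.
have : #|(z |: A) :\: R| <= (z \notin R) + #|A :\: R|.
  rewrite setDUl; apply: leq_trans (leq_card_setU _ _) _; rewrite leq_add2r.
  case: (boolP (z \in R)) => zR /=.
    by rewrite (_ : _ :\: _ = set0) ?cards0 //; apply/eqP; rewrite setD_eq0 sub1set.
  by rewrite -(cards1 z) subset_leq_card // subsetDl.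
lia.
Qed.

(** The size bound in the definition of tight sets comes for free: a union of a
    few tight sets that has deficit at most 1 is as small as each of them. *)
Lemma tight_card (T : finType) k L (R : {set T}) G v (U : {set T}) :
    sparse k L R G -> #|U| <= L -> U :&: R = [set v] ->
    (exists2 x, x \in U & [set v; x] \in G) ->
    3 * #|U :\: R| <= 2 * #|edges_in G U| + 1 ->
  tight k R G v U.
Proof.
move=> spG leU UR vx dU; split => //.
have := sparse_edges_le spG leU dU.
by rewrite -(cardsID R U) UR cards1; lia.
Qed.

(** * Guards *)

(** The set D is the region Breaker guards around v, and [out x] lists the heads
    of the edges directed away from x.  Breaker keeps all out-edges of reached
    vertices claimed; the bounds on out-degrees are what makes this possible
    with two edges per turn. *)
Record guard (T : finType) (G : {set {set T}}) (v : T) (D : {set T})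
    (out : T -> {set T}) : Prop := Guard {
  guard_root : v \in D;
  guard_out_root : out v = set0;
  guard_near : forall x, v \in out x -> x \in D /\ out x = [set v];
  guard_orient : forall x z, [set x; z] \in G -> z \in D ->
    z \in out x \/ x \in out z;
  guard_card : forall x, #|out x| <= (x \in D).+1 }.

(** A guard under construction on S: neither the bound on the out-degrees
    outside S nor the orientation of the edges leaving S is there yet, but each
    vertex carries a tight set inside S, from which the bounds for the next
    vertex are derived. *)
Record partial_guard (T : finType) (k : nat) (R : {set T}) (G : {set {set T}})
    (v : T) (S : {set T}) (out : T -> {set T}) : Prop := PartialGuard {
  pguard_root : v \in S;
  pguard_nbrs : nbrs G v \subset S;
  pguard_out_root : out v = set0;
  pguard_near : forall x, x \in S -> v \in out x -> out x = [set v];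
  pguard_orient : forall x z, [set x; z] \in G -> x \in S -> z \in S ->
    z \in out x \/ x \in out z;
  pguard_card : forall x, x \in S -> #|out x| <= 2;
  pguard_tight : forall x, x \in S -> x != v ->
    exists U, [/\ tight k R G v U, x \in U & U \subset S] }.

Section GuardExists.

Variables (T : finType) (k L : nat) (R : {set T}) (G : {set {set T}}) (v : T).
Hypotheses (spG : sparse k L R G) (leL : 3 * k.+1 + 1 <= L) (vR : v \in R).
Hypothesis (GK : G \subset complete_graph T).

Lemma edge_neq x y : [set x; y] \in G -> x != y.
Proof. by move=> /(subsetP GK); rewrite inE cards2; case: (x =P y). Qed.

Lemma tight_pair x : [set v; x] \in G -> tight k R G v [set v; x].
Proof.
move=> vx; have nvx := edge_neq vx.
have ed1 : 0 < #|edges_in G [set v; x]|.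
  by apply/card_gt0P; exists [set v; x]; rewrite inE vx subxx.
have le2 : #|[set v; x]| <= L by rewrite cards2 nvx; lia.
have xR : x \notin R.
  apply/negP=> xR; have := sparse_edges_le0 spG le2.
  suff -> : [set v; x] :\: R = set0 by rewrite cards0; lia.
  by apply/eqP; rewrite setD_eq0; apply/subsetP=> y; rewrite !inE => /orP[]/eqP->.
have UR : [set v; x] :&: R = [set v].
  apply/setP=> y; rewrite !inE; case: (y =P v) => [->|_]; first by rewrite vR.
  by case: (y =P x) => [->|_]; rewrite ?(negPf xR).
apply: (tight_card spG le2 UR); first by exists x; rewrite // !inE eqxx orbT.
have := cardsID R [set v; x]; rewrite UR cards1 cards2 nvx; lia.
Qed.

(** The closed neighbourhood of v is a star: two adjacent neighbours of v would
    form with v a set of deficit [2 * 3 - 3 * 2 = 0]. *)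
Lemma guard_start :
  partial_guard k R G v (v |: nbrs G v)
    (fun x => if x == v then set0 else [set v]).
Proof.
have noloop : [set v; v] \notin G by apply/negP=> /edge_neq; rewrite eqxx.
split.
- by rewrite !inE eqxx.
- exact: subsetUr.
- by rewrite eqxx.
- by move=> x _; case: eqP => //; rewrite inE.
- move=> x z xz; rewrite !inE.
  case: (x =P v) => [xv|/eqP xv]; case: (z =P v) => [zv|/eqP zv] /=.
  + by move: xz; rewrite xv zv (negPf noloop).
  + by rewrite xv inE eqxx; right.
  + by rewrite zv inE eqxx; left.
  move=> vx vz; have [le tR _ dU] := tight_pair vx.
  have nxz := edge_neq xz.
  have zU : z \notin [set v; x] by rewrite !inE (negPf zv) eq_sym.
  have sY : [set v; x] \subset [set v; x] :&: nbrs G z.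
    by apply/subsetP=> y; rewrite !inE => /orP[]/eqP->; rewrite eqxx ?orbT setUC.
  have := deficit_add_vertex zU sY dU.
  have leU : #|z |: [set v; x]| <= L.
    by rewrite cardsU1 zU cards2 eq_sym xv; move: leL; clear; lia.
  have := sparse_edges_lt spG leU; rewrite cards2 eq_sym xv.
  have : 0 < #|(z |: [set v; x]) :\: R|.
    have [_ xR _ _] := tight_pair vx; apply/card_gt0P; exists x.
    rewrite !inE eqxx !orbT andbT; apply: contra xv => xRR.
    by have := in_setI x [set v; x] R; rewrite xR xRR !inE eqxx orbT => ->.
  by clear; case: (z \notin R); rewrite ?muln0 ?muln1; lia.
- by move=> x _; case: eqP => _; rewrite ?cards0 ?cards1.
move=> x; rewrite !inE => + nxv; rewrite (negPf nxv) /= => vx.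
exists [set v; x]; split; first exact: tight_pair.
  by rewrite !inE eqxx orbT.
by apply/subsetP=> y; rewrite !inE => /orP[]/eqP->; rewrite ?eqxx ?vx ?orbT.
Qed.

(** Two tight sets have a union of deficit at most 2; adding z costs 3 and its
    two edges gain 4.  If z were a root, it would cost nothing and the deficit
    would become negative. *)
Lemma tight_add_vertex S out z :
    partial_guard k R G v S out -> z \notin S -> 1 < #|S :&: nbrs G z| ->
  exists U, [/\ tight k R G v U, z \in U & U \subset z |: S].
Proof.
move=> [_ /subsetP vS _ _ _ _ tS] zS /card_gt1P[x [y [xSz ySz nxy]]].
have zv w : w \in S :&: nbrs G z -> w != v.
  rewrite !inE => /andP[_ zw]; apply: contraNneq zS => wv.
  by rewrite vS // inE setUC -wv.
have inS w : w \in S :&: nbrs G z -> w \in S by rewrite inE => /andP[].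
have [A [[leA AR vA dA] xA /subsetP AS]] := tS _ (inS _ xSz) (zv _ xSz).
have [B [[leB BR _ dB] yB /subsetP BS]] := tS _ (inS _ ySz) (zv _ ySz).
have zAB : z \notin A :|: B.
  by rewrite inE; apply: contra zS => /orP[/AS|/BS].
have sY : [set x; y] \subset (A :|: B) :&: nbrs G z.
  apply/subsetP=> w; rewrite !inE => /orP[]/eqP->; rewrite ?xA ?yB ?orbT /=.
    by move: xSz; rewrite !inE => /andP[].
  by move: ySz; rewrite !inE => /andP[].
have leB' : #|B| <= L by move: leB leL; clear; lia.
have := deficit_add_vertex zAB sY (deficit_setU spG leB' dA dB).
have leU : #|z |: (A :|: B)| <= L.
  rewrite cardsU1 zAB; have := (leq_card_setU A B).1.
  by move: leA leB leL; clear; lia.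
have := sparse_edges_le0 spG leU; rewrite cards2 nxy.
case: (boolP (z \in R)) => zR; rewrite ?muln0 ?muln1; first by clear=> *; exfalso; lia.
move=> _ dU.
have dU' : 3 * #|(z |: (A :|: B)) :\: R| <= 2 * #|edges_in G (z |: (A :|: B))| + 1.
  by move: dU; clear; lia.
exists (z |: (A :|: B)); split.
- apply: (tight_card spG leU); last exact: dU'.
    rewrite setIUl setIUl AR BR setUid (_ : _ :&: _ = set0) ?set0U //.
    by apply/setP=> w; rewrite !inE; case: eqP => // ->; exact: negPf.
  by case: vA => w wA vw; exists w; rewrite // !inE wA orbT.
- by rewrite !inE eqxx.
by apply: setUS; apply/subsetP=> w; rewrite inE => /orP[/AS|/BS].
Qed.

(** Three tight sets and a vertex with an edge to each of them would have
    deficit at most [3 + 3 - 6 = 0]. *)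
Lemma card_nbrs_partial_guard S out z :
  partial_guard k R G v S out -> z \notin S -> #|S :&: nbrs G z| <= 2.
Proof.
move=> [_ /subsetP vS _ _ _ _ tS] zS; rewrite leqNgt; apply/negP.
move=> /card_gt2P[x [y [w [[xSz ySz wSz] [nxy nyw nwx]]]]].
have zv u : u \in S :&: nbrs G z -> u != v.
  rewrite !inE => /andP[_ zu]; apply: contraNneq zS => uv.
  by rewrite vS // inE setUC -uv.
have inS u : u \in S :&: nbrs G z -> u \in S by rewrite inE => /andP[].
have [A [[leA AR [a aA va] dA] xA /subsetP AS]] := tS _ (inS _ xSz) (zv _ xSz).
have [B [[leB BR _ dB] yB /subsetP BS]] := tS _ (inS _ ySz) (zv _ ySz).
have [C [[leC CR _ dC] wC /subsetP CS]] := tS _ (inS _ wSz) (zv _ wSz).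
have zABC : z \notin A :|: B :|: C.
  by rewrite !inE; apply: contra zS => /orP[/orP[/AS|/BS]|/CS].
have sY : [set x; y; w] \subset (A :|: B :|: C) :&: nbrs G z.
  apply/subsetP=> u; rewrite !inE => /orP[/orP[]|]/eqP->;
    rewrite ?xA ?yB ?wC ?orbT /=.
  - by move: xSz; rewrite !inE => /andP[].
  - by move: ySz; rewrite !inE => /andP[].
  - by move: wSz; rewrite !inE => /andP[].
have cY : #|[set x; y; w]| = 3.
  by rewrite setUC cardsU1 cards2 nxy !inE (negPf nwx) eq_sym (negPf nyw).
have leB' : #|B| <= L by move: leB leL; clear; lia.
have leC' : #|C| <= L by move: leC leL; clear; lia.
have := deficit_add_vertex zABC sY
  (deficit_setU spG leC' (deficit_setU spG leB' dA dB) dC).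
have leU : #|z |: (A :|: B :|: C)| <= L.
  rewrite cardsU1 zABC; have := (leq_card_setU A B).1.
  have := (leq_card_setU (A :|: B) C).1.
  by move: leA leB leC leL; clear; lia.
have := sparse_edges_lt spG leU; rewrite cY.
have : 0 < #|(z |: (A :|: B :|: C)) :\: R|.
  apply/card_gt0P; exists a; rewrite !inE aA !orbT andbT.
  apply/negP=> aR; have : a \in A :&: R by rewrite inE aA.
  by rewrite AR inE => /eqP av; move: (edge_neq va); rewrite av eqxx.
by clear; case: (z \notin R); rewrite ?muln0 ?muln1; lia.
Qed.

Lemma guard_step S out z :
    partial_guard k R G v S out -> z \notin S -> 1 < #|S :&: nbrs G z| ->
  partial_guard k R G v (z |: S)
    (fun x => if x == z then S :&: nbrs G z else out x).
Proof.
move=> gS zS lt1; have [U [tU zU US]] := tight_add_vertex gS zS lt1.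
have le2 := card_nbrs_partial_guard gS zS.
case: gS => vS /subsetP nS ov nearS orS cS tS.
have neqz x : x \in S -> x != z by move=> xS; apply: contraNneq zS => <-.
split.
- by rewrite inE vS orbT.
- by apply/subsetP=> x /nS xS; rewrite inE xS orbT.
- by rewrite (negPf (neqz _ vS)).
- move=> x; rewrite !inE; case: eqP => [-> _|_ /=]; last exact: nearS.
  rewrite !inE vS => /= zv; case/negP: zS; apply: nS.
  by rewrite inE setUC.
- move=> x y xy; rewrite !inE; case: (x =P z) => [xz|_] /=.
    case: (y =P z) => [yz|_] /=; first by move: (edge_neq xy); rewrite xz yz eqxx.
    by move=> _ yS; left; rewrite inE yS -xz inE.
  case: (y =P z) => [yz|_] /=; last exact: orS.
  by move=> xS _; right; rewrite inE xS -yz inE setUC.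
- by move=> x; rewrite !inE; case: eqP => // _ /=; exact: cS.
move=> x; rewrite !inE => /orP[/eqP-> _|xS xv]; first by exists U.
have [W [tW xW WS]] := tS _ xS xv; exists W; split=> //.
by apply: subset_trans WS _; exact: subsetUr.
Qed.

(** A partial guard that cannot be extended becomes a guard once each vertex
    outside directs its at most one edge into D. *)
Lemma exists_guard : exists D out,
  [/\ guard G v D out,
      forall x, x \notin D -> out x = D :&: nbrs G x
    & forall x, x \in D -> x != v -> exists2 U, tight k R G v U & x \in U].
Proof.
have := guard_start; move: (v |: nbrs G v) (fun x => _) => S out.
have [m] := ubnP #|~: S|; elim: m S out => // m IHm S out ltm gS.
case: (pickP (fun z => (z \notin S) && (1 < #|S :&: nbrs G z|))) => [z|none].
  move=> /andP[zS lt1]; apply: IHm (guard_step gS zS lt1).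
  rewrite -ltnS; apply: leq_trans ltm; rewrite ltnS; apply: proper_card.
  apply/properP; split; first by rewrite setCS subsetUr.
  by exists z; rewrite !inE ?eqxx.
have leS z : z \notin S -> #|S :&: nbrs G z| <= 1.
  by move=> zS; have := none z; rewrite zS /= => /negbT; rewrite -leqNgt.
case: gS => vS /subsetP nS ov nearS orS cS tS.
exists S, (fun x => if x \in S then out x else S :&: nbrs G x); split.
- split => //.
  + by rewrite vS.
  + move=> x; case: (boolP (x \in S)) => [xS vx|xS]; first by split => //; exact: nearS.
    by rewrite !inE => /andP[_ xv]; case/negP: xS; apply: nS; rewrite inE setUC.
  + move=> x z xz zS; rewrite zS; case: (boolP (x \in S)) => xS; first exact: orS.
    by left; rewrite !inE zS.
  by move=> x; case: (boolP (x \in S)) => xS; [exact: cS | exact: leS].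
- by move=> x /negPf->.
by move=> x xS xv; have [U [tU xU _]] := tS _ xS xv; exists U.
Qed.

End GuardExists.

Definition guarded_edges (T : finType) (G : {set {set T}}) (out : T -> {set T})
    (K : {set T}) : {set {set T}} :=
  [set e in G | [exists x in K, [exists y in out x, e == [set x; y]]]].

Lemma guarded_edgesP (T : finType) (G : {set {set T}})
    (out : T -> {set T}) (K : {set T}) e :
  reflect (exists x y, [/\ e \in G, x \in K, y \in out x & e = [set x; y]])
          (e \in guarded_edges G out K).
Proof.
rewrite inE; apply: (iffP andP).
  by move=> [eG /exists_inP[x xK /exists_inP[y yo /eqP ee]]]; exists x, y.
move=> [x [y [eG xK yo ee]]]; split=> //.
by apply/exists_inP; exists x => //; apply/exists_inP; exists y; rewrite ?ee.
Qed.

(** Suppose every root outside K is spoiled: some tight set U of v meets K or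
    has an edge to K.  Add these sets to K one by one.  If U is disjoint from
    the union A built so far, its deficit 1 is outweighed by the edge to K,
    which gains 2; otherwise the intersection contains a vertex outside R and
    has deficit at least 1.  So the deficit of A stays at most 12, its value
    for four vertices, and A has at most [12 * k] edges, although each root
    brings a new one. *)
Lemma exists_far_guard (T : finType) k L (R : {set T}) (G : {set {set T}})
    (K : {set T}) :
    sparse k L R G -> 4 + (12 * k).+1 * k.+1 <= L -> G \subset complete_graph T ->
    12 * k + 4 < #|R| -> #|K| <= 4 ->
  exists v D out, [/\ guard G v D out, v \notin K & guarded_edges G out K = set0].
Proof.
move=> spG leL GK ltR leK.
apply: contrapT => none.
have leL3 : 3 * k.+1 + 1 <= L by move: leL; clear; nia.
have near v : v \in R -> v \notin K -> exists U,
    tight k R G v U /\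
    (U :&: K != set0 \/ exists x y, [/\ x \in K, y \in U & [set x; y] \in G]).
  move=> vR vK.
  have [D [out [gD oD tD]]] := exists_guard spG leL3 vR GK.
  have [xDK|DK] := boolP (K :&: D != set0).
    case/set0Pn: xDK => x; rewrite inE => /andP[xK xD].
    have xv : x != v by apply: contraNneq vK => <-.
    have [U tU xU] := tD _ xD xv; exists U; split=> //; left.
    by apply/set0Pn; exists x; rewrite inE xU.
  have nD x : x \in K -> x \notin D.
    move=> xK; apply: contra DK => xD; apply/set0Pn; exists x.
    by rewrite inE xK.
  have [e0|] := eqVneq (guarded_edges G out K) set0.
    by case: none; exists v, D, out.
  case/set0Pn=> e /guarded_edgesP[x [y [eG xK + ee]]].
  rewrite oD ?nD // !inE => /andP[yD xy].
  have yv : y != v.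
    apply: contraNneq (nD _ xK) => yv.
    have : v \in out x by rewrite oD ?nD // !inE -yv yD.
    by case/(guard_near gD).
  have [U tU yU] := tD _ yD yv; exists U; split=> //; right.
  by exists x, y.
(* The last bound counts the edges at the roots in s, one for each of them. *)
have grow (s : seq T) : uniq s -> {subset s <= R :\: K} -> size s <= (12 * k).+1 ->
  exists A : {set T}, [/\ K \subset A, #|A| <= 4 + size s * k.+1,
    A :&: R \subset K :|: [set x in s],
    3 * #|A :\: R| <= 2 * #|edges_in G A| + 12 & size s <= #|edges_in G A|].
  elim: s => [|v s IHs].
    move=> _ _ _; exists K; split => //; first by rewrite subIset // subsetUl.
    apply: leq_trans (leq_addl _ _); rewrite (leq_mul2l 3 _ 4).
    by apply: leq_trans leK; rewrite subset_leq_card // subsetDl.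
  rewrite cons_uniq => /andP[vs us] sR les.
  have [||A [KA leA AR dA leE]] := IHs us.
  - by move=> x xs; apply: sR; rewrite inE xs orbT.
  - exact: ltnW.
  have := sR v (mem_head _ _); rewrite inE => /andP[vK vR].
  have vA : v \notin A.
    apply/negP=> vA; have := subsetP AR v; rewrite !inE vA vR (negPf vK) /=.
    by move=> /(_ isT); apply/negP.
  have [U [[leU UR [x xU vx] dU] touch]] := near v vR vK.
  have leUL : #|U| <= L by move: leU leL3; clear; lia.
  have leIL : #|A :&: U| <= L.
    by apply: leq_trans leUL; rewrite subset_leq_card // subsetIr.
  exists (A :|: U); split.
  - exact: subset_trans KA (subsetUl _ _).
  - have := (leq_card_setU A U).1; move: leA leU; clear; rewrite /=; lia.
  - rewrite setIUl UR subUset; apply/andP; split.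
      apply: subset_trans AR _; apply: setUS; apply/subsetP=> y.
      by rewrite !inE => ->; rewrite orbT.
    by rewrite sub1set !inE eqxx orbT.
  - have : 3 * #|U :\: R| + 2 * #|edges_in G A| <=
           2 * #|edges_in G (A :|: U)| + 3 * #|(A :&: U) :\: R|.
      have [I0|In0] := eqVneq (A :&: U) set0.
        case: touch => [/set0Pn[y]|[y [z [yK zU yz]]]].
          rewrite inE => /andP[yU yK].
          have : y \in A :&: U by rewrite inE yU (subsetP KA).
          by rewrite I0 inE.
        have := edges_in_linked GK I0 (subsetP KA _ yK) zU yz.
        by move: dU; clear; lia.
      have pos : 0 < #|(A :&: U) :\: R|.
        case/set0Pn: In0 => y yI; apply/card_gt0P; exists y.
        rewrite inE yI andbT; apply/negP=> yR.
        move: yI; rewrite inE => /andP[yA yU].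
        have : y \in U :&: R by rewrite inE yU.
        by rewrite UR inE => /eqP yv; move: vA; rewrite -yv yA.
      have := sparse_edges_lt spG leIL pos.
      have := edges_in_setU G A U.
      by move: dU; clear; lia.
    have := cardsUI (A :\: R) (U :\: R); rewrite -setDUl -setDIl.
    by move: dA; clear; lia.
  apply: leq_ltn_trans leE _; apply: proper_card; apply/properP; split.
    apply/subsetP=> e; rewrite !inE => /andP[-> /=] /subset_trans; apply.
    exact: subsetUl.
  exists [set v; x].
    rewrite inE vx; apply/subsetP=> y; rewrite !inE => /orP[]/eqP->.
      have : v \in U :&: R by rewrite UR inE.
      by rewrite inE => /andP[-> _]; rewrite orbT.
    by rewrite xU orbT.
  rewrite inE vx; apply: contra vA => /subsetP; apply.
  by rewrite !inE eqxx.
pose s := take (12 * k).+1 (enum (R :\: K)).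
have szs : size s = (12 * k).+1.
  rewrite size_takel // -cardE.
  have := cardsID K R; have : #|R :&: K| <= #|K|.
    by rewrite subset_leq_card // subsetIr.
  by move: ltR leK; clear; lia.
have [|||A [_ leA _ dA leE]] := grow s.
- exact/take_uniq/enum_uniq.
- by move=> x /mem_take; rewrite mem_enum.
- by rewrite szs.
rewrite szs in leA leE.
have := sparse_edges_le spG (leq_trans leA leL) dA.
by move: leE; clear; lia.
Qed.

(** * One round of the game *)

Lemma connected_edges_cross (T : finType) (E : {set {set T}}) (A : {set T})
    (u w : T) :
    connected_edges E -> u \in cover E -> w \in cover E -> u \in A ->
    w \notin A ->
  exists x y, [/\ x \in A, y \notin A & [set x; y] \in E].
Proof.
move=> cE uE wE uA wA; apply: contrapT => none.
have clA : closed [rel x y | [set x; y] \in E] (mem A).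
  move=> x y /= xy; apply/idP/idP => [xA|yA]; apply: contrapT => /negP nA.
    by apply: none; exists x, y.
  by apply: none; exists y, x; split=> //; rewrite setUC.
by have := closed_connect clA (cE _ _ uE wE); rewrite uA (negPf wA).
Qed.

Lemma mem_cover_edge (T : finType) (E : {set {set T}}) x y :
  [set x; y] \in E -> (x \in cover E) && (y \in cover E).
Proof.
move=> xy; apply/andP; split; apply/bigcupP; exists [set x; y] => //.
  by rewrite !inE eqxx.
by rewrite !inE eqxx orbT.
Qed.

Lemma cover_setU (T : finType) (E F : {set {set T}}) :
  cover (E :|: F) = cover E :|: cover F.
Proof. exact: bigcup_setU. Qed.

(** Crossing the cut around the new vertices yields an edge [xu] from a new
    vertex to an old one.  If there are further new vertices, crossing the cut
    around those yields a second edge [zt], and then c is used up. *)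
Lemma new_verticesP (T : finType) (C c : {set {set T}}) :
    connected_edges (C :|: c) -> #|c| <= 2 -> cover C != set0 ->
  [\/ cover (C :|: c) :\: cover C = set0,
      exists x u, [/\ cover (C :|: c) :\: cover C = [set x], u \in cover C
                    & [set x; u] \in c]
    | exists x z u t, [/\ cover (C :|: c) :\: cover C = [set x; z],
                          x != z, u \in cover C & t \in x |: cover C] /\
                      [set x; u] \in c /\ [set z; t] \in c].
Proof.
move=> cE le2 /set0Pn[w wC].
set N := _ :\: _.
have [->|/set0Pn[a aN]] := eqVneq N set0; first by constructor 1.
have wCc : w \in cover (C :|: c) by rewrite cover_setU inE wC.
have NC x : x \in N -> x \notin cover C by rewrite inE => /andP[].
have Ncov x : x \in N -> x \in cover (C :|: c) by rewrite inE => /andP[].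
have wN : w \notin N by rewrite inE wC.
have cross (M : {set T}) b : M \subset N -> b \in M -> exists x y,
    [/\ x \in M, y \notin M, [set x; y] \in c & y \in cover (C :|: c)].
  move=> /subsetP MN bM; have wM : w \notin M by apply: contra wN => /MN.
  have [x [y [xM yM xy]]] :=
    connected_edges_cross cE (Ncov _ (MN _ bM)) wCc bM wM.
  exists x, y; split=> //; last by case/andP: (mem_cover_edge xy).
  move: xy; rewrite inE => /orP[/mem_cover_edge /andP[xC _]|//].
  by case/negP: (NC _ (MN _ xM)).
have [x [u [xN uN xu uCc]]] := cross N a (subxx _) aN.
have uC : u \in cover C by move: uN; rewrite inE uCc andbT negbK.
have [N1|/set0Pn[b bN]] := eqVneq (N :\ x) set0.
  constructor 2; exists x, u; split=> //.
  apply/eqP; rewrite eqEsubset sub1set xN andbT.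
  by move/eqP: N1; rewrite setD_eq0.
have [z [t [zN tN zt tCc]]] := cross (N :\ x) b (subsetDl _ _) bN.
move: zN; rewrite !inE => /andP[zx /andP[zC zCc]].
have zN : z \in N by rewrite inE zC zCc.
have tx : t \in x |: cover C.
  move: tN; rewrite !inE tCc andbT; case: (t =P x) => //= _.
  by rewrite negbK.
constructor 3; exists x, z, u, t; split; last by split.
split=> //; last by rewrite eq_sym.
have neq : [set x; u] != [set z; t].
  apply/eqP=> /setP/(_ z); rewrite !inE eqxx (negPf zx) /= => /eqP zu.
  by move: zC; rewrite zu uC.
have cE2 : c = [set [set x; u]; [set z; t]].
  apply/esym/eqP; rewrite eqEcard cards2 neq le2 andbT.
  by apply/subsetP=> e; rewrite !inE => /orP[]/eqP->.
apply/eqP; rewrite eqEsubset; apply/andP; split; last first.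
  by rewrite subUset !sub1set xN.
apply/subsetP=> y yN.
have : y \in cover c.
  by have := Ncov _ yN; rewrite cover_setU inE (negPf (NC _ yN)).
case/bigcupP=> e; rewrite cE2 !inE => /orP[]/eqP->; rewrite !inE => /orP[]/eqP ye.
- by rewrite ye eqxx.
- by case/negP: (NC _ yN); rewrite ye.
- by rewrite ye eqxx orbT.
move: tx; rewrite !inE -ye => /orP[-> //|yC].
by case/negP: (NC _ yN).
Qed.

Section Response.

Variables (T : finType) (G : {set {set T}}) (v : T) (D : {set T}).
Variables (out : T -> {set T}) (C c : {set {set T}}).
Hypotheses (gD : guard G v D out) (connCc : connected_edges (C :|: c)).
Hypotheses (le2 : #|c| <= 2) (C0 : cover C != set0) (vC : v \notin cover C).
Hypothesis cG : c \subset G :\: guarded_edges G out (cover C).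

(** An old vertex u has no free out-edge, so an edge from u into D that is still
    free is directed towards u. *)
Lemma claimed_edge_orient x u :
  u \in cover C -> [set x; u] \in c -> x \in D -> u \in out x.
Proof.
move=> uC xu xD; have := subsetP cG _ xu; rewrite inE => /andP[ng xuG].
have uxG : [set u; x] \in G by rewrite setUC.
case: (guard_orient gD uxG xD) => // xu'.
by case/guarded_edgesP: ng; exists u, x; split=> //; rewrite setUC.
Qed.

(** The last edge towards v would start at a neighbour x of v whose only
    out-edge leads to v; but x would have been entered along an out-edge of x
    to an old vertex. *)
Lemma root_not_new : v \notin cover (C :|: c).
Proof.
have noK u : u \in cover C -> [set v; u] \notin c.
  move=> uC; apply/negP=> /(claimed_edge_orient uC) /(_ (guard_root gD)).
  by rewrite (guard_out_root gD) inE.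
apply/negP=> vCc; have : v \in cover (C :|: c) :\: cover C by rewrite inE vC.
case: (new_verticesP connCc le2 C0) => [->|[x [u [-> uC xu]]]|]; first by rewrite inE.
  by rewrite inE => /eqP vx; move: (noK _ uC); rewrite vx xu.
move=> [x [z [u [t [[-> xz uC tx] [xu zt]]]]]]; rewrite !inE => /orP[]/eqP vE.
  by move: (noK _ uC); rewrite vE xu.
move: tx; rewrite !inE => /orP[/eqP tx|tC]; last first.
  by move: (noK _ tC); rewrite vE zt.
have xvG : [set x; v] \in G.
  by have := subsetP cG _ zt; rewrite tx -vE setUC inE => /andP[].
case: (guard_orient gD xvG (guard_root gD)) => [/(guard_near gD)[xD ox]|].
  have := claimed_edge_orient uC xu xD; rewrite ox inE => /eqP uv.
  by move: vC; rewrite -uv uC.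
by rewrite (guard_out_root gD) inE.
Qed.

Let rest x := [set [set x; y] | y in out x] :\: c.

Lemma card_rest x (F : {set T}) :
    F \subset out x -> (forall y, y \in F -> [set x; y] \in c) ->
  #|rest x| + #|F| <= #|out x|.
Proof.
move=> Fo Fc; rewrite -(cardsID F (out x)) (setIidPr Fo) addnC leq_add2l.
apply: leq_trans (leq_imset_card (fun y => [set x; y]) (out x :\: F)).
apply: subset_leq_card; apply/subsetP=> e; rewrite inE => /andP[ec].
case/imsetP=> y yo ee; apply/imsetP; exists y => //; rewrite inE yo andbT.
by apply: contra ec => /Fc; rewrite -ee.
Qed.

Lemma card_rest_old x u : u \in cover C -> [set x; u] \in c -> #|rest x| <= 1.
Proof.
move=> uC xu; have := guard_card gD x; have [xD|xD] := boolP (x \in D).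
  have uo := claimed_edge_orient uC xu xD.
  have := @card_rest x [set u]; rewrite sub1set uo cards1 => /(_ isT) h gx.
  rewrite -(leq_add2r 1); apply: leq_trans (h _) gx.
  by move=> y; rewrite inE => /eqP->.
have := @card_rest x set0 (sub0set _); rewrite cards0 addn0 => h1 h2.
by apply: leq_trans (h1 _) h2 => y; rewrite inE.
Qed.

(** A new vertex entered from an old one keeps at most one free out-edge.  Only a
    vertex z entered from a new vertex x along an out-edge of x may keep two;
    but then Connector has used up all out-edges of x. *)
Lemma card_response :
  #|guarded_edges G out (cover (C :|: c))
      :\: guarded_edges G out (cover C) :\: c| <= 2.
Proof.
have sub (N : {set T}) : cover (C :|: c) :\: cover C = N ->
    guarded_edges G out (cover (C :|: c)) :\: guarded_edges G out (cover C)
      :\: c \subset \bigcup_(x in N) rest x.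
  move=> <-; apply/subsetP=> e; rewrite 2!inE => /andP[ec /andP[ng]].
  case/guarded_edgesP=> x [y [eG xCc yo ee]].
  apply/bigcupP; exists x; last by rewrite inE ec /=; apply/imsetP; exists y.
  rewrite inE xCc andbT; apply: contra ng => xC.
  by apply/guarded_edgesP; exists x, y.
case: (new_verticesP connCc le2 C0) => [/sub|[x [u [/sub sN uC xu]]]|].
- by rewrite big_set0 subset0 => /eqP->; rewrite cards0.
- apply: leq_trans (subset_leq_card sN) _; rewrite big_set1.
  by apply: leq_trans (card_rest_old uC xu) _.
move=> [x [z [u [t [[NE xz uC tx] [xu zt]]]]]].
apply: leq_trans (subset_leq_card (sub _ NE)) _.
rewrite big_setU1 ?inE //= big_set1.
apply: leq_trans (leq_card_setU _ _) _.
have zC : z \notin cover C.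
  have : z \in [set x; z] by rewrite !inE eqxx orbT.
  by rewrite -NE inE => /andP[].
have rx := card_rest_old uC xu.
move: tx; rewrite !inE => /orP[/eqP tE|tC]; last first.
  exact: leq_add rx (card_rest_old tC zt).
move: zt; rewrite tE => zx.
have card0 w : #|rest w| <= #|out w|.
  have := @card_rest w set0 (sub0set _); rewrite cards0 addn0; apply.
  by move=> y; rewrite inE.
have gz := guard_card gD z; have rz := card0 z.
have [zD|zD] := boolP (z \in D); last first.
  by rewrite (negPf zD) in gz; apply: leq_add rx (leq_trans rz gz).
rewrite zD in gz.
have xzG : [set x; z] \in G.
  by have := subsetP cG _ zx; rewrite setUC inE => /andP[].
case: (guard_orient gD xzG zD) => [zo|xo]; last first.
  have := @card_rest z [set x]; rewrite sub1set xo cards1 => /(_ isT) h.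
  have {}h : #|rest z| + 1 <= #|out z|.
    by apply: h => y; rewrite inE => /eqP->.
  apply: leq_add rx _; rewrite -(leq_add2r 1); exact: leq_trans h gz.
have gx := guard_card gD x.
have [xD|xD] := boolP (x \in D); last first.
  have := @card_rest x [set z]; rewrite sub1set zo cards1 => /(_ isT) h.
  have {}h : #|rest x| + 1 <= #|out x|.
    by apply: h => y; rewrite inE => /eqP->; rewrite setUC.
  rewrite (negPf xD) in gx; apply: (@leq_add _ _ 0 2) (leq_trans rz gz).
  by rewrite -(leq_add2r 1); exact: leq_trans h gx.
have uo := claimed_edge_orient uC xu xD.
have zu : z != u by apply: contraNneq zC => ->.
have := @card_rest x [set z; u]; rewrite subUset !sub1set zo uo cards2 zu => /(_ isT) h.
have {}h : #|rest x| + 2 <= #|out x|.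
  by apply: h => y; rewrite !inE => /orP[]/eqP->; rewrite // setUC.
rewrite xD in gx; apply: (@leq_add _ _ 0 2) (leq_trans rz gz).
by rewrite -(leq_add2r 2); exact: leq_trans h gx.
Qed.

End Response.

(** * The strategy *)

Definition first_nonempty (T : finType) (h : seq {set {set T}}) :=
  head set0 [seq x <- h | x != set0].

(** The guard is chosen by [sel] after Connector's first nonempty move.  Earlier
    moves of Breaker need not be recorded: they are out-edges of vertices that
    were reached before the last move of Connector, and these are removed. *)
Definition guard_strategy (T : finType) (G : {set {set T}})
    (sel : {set {set T}} -> T -> {set T}) (h : seq {set {set T}}) :=
  let out := sel (first_nonempty h) in
  guarded_edges G out (cover (\bigcup_(x <- h) x))
    :\: guarded_edges G out
          (cover (\bigcup_(x <- take (size h).-1 h) x))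
    :\: \bigcup_(x <- h) x.

Lemma bigcup_mkseq (T : finType) (c : nat -> {set T}) k :
  \bigcup_(x <- mkseq c k) x = \bigcup_(i < k) c i.
Proof. by rewrite /mkseq big_map -{1}(subn0 k) big_mkord. Qed.

Lemma guard_strategyE (T : finType) (G : {set {set T}}) sel c k :
  guard_strategy G sel (mkseq c k.+1) =
  guarded_edges G (sel (first_nonempty (mkseq c k.+1)))
      (cover (\bigcup_(i < k.+1) c i))
    :\: guarded_edges G (sel (first_nonempty (mkseq c k.+1)))
          (cover (\bigcup_(i < k) c i))
    :\: \bigcup_(i < k.+1) c i.
Proof.
rewrite /guard_strategy size_mkseq bigcup_mkseq.
by rewrite {2}/mkseq -map_take take_iota (minn_idPl (leqnSn k)) bigcup_mkseq.
Qed.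

Lemma first_nonempty_mkseq (T : finType) (c : nat -> {set {set T}}) k0 k :
    (forall i, i < k0 -> c i = set0) -> c k0 != set0 -> k0 <= k ->
  first_nonempty (mkseq c k.+1) = c k0.
Proof.
move=> c0 ck0 lek; rewrite /first_nonempty /mkseq.
have -> : iota 0 k.+1 = iota 0 k0 ++ k0 :: iota k0.+1 (k - k0).
  by rewrite -{1}(subnKC (leqW lek)) iotaD subSn.
rewrite map_cat filter_cat (_ : [seq x <- map c (iota 0 k0) | _] = [::]) /=.
  by rewrite ck0.
apply/eqP; rewrite -[_ == _]negbK -has_filter; apply/hasPn=> x /mapP[i].
by rewrite mem_iota /= => ltk ->; rewrite c0 // eqxx.
Qed.

(** Breaker waits until Connector's first nonempty move and then fixes a guard
    without out-edges at the at most four vertices of that move.  By induction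
    all out-edges of reached vertices are claimed after each of his replies. *)
Lemma breaker_can_isolate_guards (T : finType) (G : {set {set T}}) :
    G \subset complete_graph T ->
    (forall K : {set T}, #|K| <= 4 -> exists v D out,
      [/\ guard G v D out, v \notin K & guarded_edges G out K = set0]) ->
  breaker_can_isolate 2 2 G.
Proof.
move=> GK guards.
have {guards} /choice[sel selP] : forall F : {set {set T}},
    exists out, #|cover F| <= 4 -> exists v D,
      [/\ guard G v D out, v \notin cover F & guarded_edges G out (cover F) = set0].
  move=> F; have [/guards[v [D [out gs]]]|_] := boolP (#|cover F| <= 4).
    by exists out => _; exists v, D.
  by exists (fun=> set0).
exists (guard_strategy G sel) => c b legal.
have bE k : b k = guard_strategy G sel (mkseq c k.+1) by [].
clearbody b.
have c_new k e : e \in c k -> e \notin claimed_before c b k.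
  by case: (legal k) => _ /subsetP cG _ /cG; rewrite inE; case/andP.
have cG k : c k \subset G.
  by case: (legal k) => _ cG _; apply: subset_trans cG (subsetDl _ _).
pose C k := \bigcup_(i < k) c i.
have CS k : C k.+1 = C k :|: c k by rewrite /C big_ord_recr.
have sC i k : i < k -> c i \subset C k.
  by move=> lt; exact: (bigcup_sup (Ordinal lt)).
have [alwaysempty|] := pselect (forall k, c k = set0).
  have C0 k : C k = set0 by apply: big1 => i _.
  have b0 k : b k = set0.
    rewrite bE guard_strategyE -/(C k.+1) -/(C k) !C0.
    by rewrite setDv set0D.
  have [|v _] := selP set0; first by rewrite /cover big_set0 cards0.
  split; last by exists v => k; rewrite alwaysempty /cover big_set0 inE.
  by move=> k; rewrite b0 cards0 sub0set.
move=> notallempty.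
have [k0 [ck0 c0]] : exists k0, c k0 != set0 /\ forall i, i < k0 -> c i = set0.
  have /cid[m /eqP cm] : exists m, c m <> set0.
    by apply/existsNP.
  have ex : exists m, c m != set0 by exists m.
  exists (ex_minn ex); case: ex_minnP => j cj minj; split=> // i.
  by rewrite ltnNge => /negP lt; apply: contrapT => /eqP /minj.
have le4 : #|cover (c k0)| <= 4.
  apply: leq_trans (leq_card_cover _) _; rewrite (eq_bigr (fun=> 2)) => [|e ec].
    by rewrite sum_nat_const (leq_mul2r 2 _ 2); case: (legal k0).
  by have := subsetP GK _ (subsetP (cG _) _ ec); rewrite inE => /eqP.
have [v [D [gD vF gF]]] := selP _ le4.
pose g K := guarded_edges G (sel (c k0)) K.
have gS (K K' : {set T}) : K \subset K' -> g K \subset g K'.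
  move=> /subsetP KK; apply/subsetP=> e /guarded_edgesP[x [y [eG xK yo ee]]].
  by apply/guarded_edgesP; exists x, y; split=> //; exact: KK.
have g0 : g set0 = set0.
  by apply/setP=> e; rewrite [RHS]inE; apply/guarded_edgesP=> -[x [y []]]; rewrite inE.
have coverS (E F : {set {set T}}) : E \subset F -> cover E \subset cover F.
  by move=> EF; rewrite -(setUidPr EF) cover_setU subsetUl.
have cov0 : cover (set0 : {set {set T}}) = set0 by rewrite /cover big_set0.
have C0 k : k <= k0 -> C k = set0.
  by move=> lek; apply: big1 => i _; apply: c0; apply: leq_trans lek.
have Ck0 : C k0.+1 = c k0 by rewrite CS C0 // set0U.
have CS2 i k : i <= k -> C i \subset C k.
  elim: k => [|k IHk]; first by rewrite leqn0 => /eqP->.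
  rewrite leq_eqVlt ltnS => /orP[/eqP->//|/IHk iC].
  by rewrite CS; apply: subset_trans iC (subsetUl _ _).
have bE' k : b k = g (cover (C k.+1)) :\: g (cover (C k)) :\: C k.+1.
  rewrite bE guard_strategyE -/(C k.+1) -/(C k).
  have [lek|ltk] := leqP k0 k; first by rewrite (first_nonempty_mkseq c0 ck0 lek).
  by rewrite (C0 _ ltk) (C0 _ (ltnW ltk)) !setDv ?set0D.
have claimedS k : claimed_before c b k.+1 = claimed_before c b k :|: (c k :|: b k).
  by rewrite /claimed_before big_ord_recr.
have gclaimed k : g (cover (C k)) \subset claimed_before c b k.
  elim: k => [|k IHk]; first by rewrite C0 // cov0 g0 sub0set.
  apply/subsetP=> e eg; rewrite claimedS.
  have [eC|eC] := boolP (e \in C k.+1).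
    case/bigcupP: eC => i _ ei; have := ltn_ord i; rewrite ltnS leq_eqVlt.
    case/orP=> [/eqP<-|lti]; first by rewrite !inE ei orbT.
    rewrite inE; apply/orP; left; apply/bigcupP; exists (Ordinal lti) => //.
    by rewrite inE ei.
  have [egk|egk] := boolP (e \in g (cover (C k))).
    by rewrite inE (subsetP IHk).
  have -> // : e \in claimed_before c b k :|: (c k :|: b k).
  by rewrite !inE bE' 2!inE eC egk eg !orbT.
have cGg k : c k \subset G :\: g (cover (C k)).
  apply/subsetP=> e ec; rewrite inE (subsetP (cG k)) // andbT.
  by apply: contra (c_new _ _ ec) => /(subsetP (gclaimed k)).
have Cn0 k : k0 < k -> cover (C k) != set0.
  move=> ltk; have [e ec] := set0Pn _ ck0.
  have : #|e| == 2 by have := subsetP GK _ (subsetP (cG _) _ ec); rewrite inE.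
  case/cards2P=> x [y [_ ee]]; apply/set0Pn; exists x.
  apply: (subsetP (coverS _ _ (CS2 _ _ ltk))); rewrite Ck0.
  by apply/bigcupP; exists e; rewrite // ee !inE eqxx.
have conn k : connected_edges (C k :|: c k) by rewrite -CS; case: (legal k).
have le2 k : #|c k| <= 2 by case: (legal k).
have vC k : v \notin cover (C k).
  elim: k => [|k IHk]; first by rewrite C0 // cov0 inE.
  have [ltk|ltk|->] := ltngtP k k0.
  - by rewrite C0 // cov0 inE.
  - by rewrite CS (root_not_new gD (conn k)) // ?Cn0 //; exact: cGg.
  - by rewrite Ck0.
split; last first.
  exists v => k; apply: contra (vC k.+1); apply/subsetP/coverS.
  by rewrite CS subsetUr.
move=> k; split.
  rewrite bE'; have [ltk|ltk|->] := ltngtP k k0.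
  - by rewrite [C k.+1]C0 // cov0 g0 !set0D cards0.
  - apply: leq_trans (card_response gD (conn k) (le2 k) (Cn0 _ ltk) (cGg k)).
    by rewrite CS; apply: subset_leq_card; apply: setDS; exact: subsetUr.
  - by rewrite Ck0 [g (cover (c k0))]gF !set0D cards0.
apply/subsetP=> e; rewrite bE' 2!inE => /andP[eC /andP[eg egS]].
rewrite !inE (_ : e \in G) ?andbT; last by move: egS; rewrite inE => /andP[].
rewrite negb_or; apply/andP; split; last first.
  by apply: contra eC; apply/subsetP; rewrite CS subsetUr.
apply/bigcupP=> -[i _]; rewrite inE => /orP[ei|].
  by case/negP: eC; apply: (subsetP (sC i _ _)) => //; exact: ltnW (ltn_ord i).
rewrite bE' 2!inE => /andP[_ /andP[_ egi]]; case/negP: eg.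
by apply: (subsetP (gS _ _ _) _ egi); apply/coverS/CS2.
Qed.

(** * First-moment bounds in the binomial random graph *)

Import Order.TTheory GRing.Theory Num.Theory.
Local Open Scope ring_scope.

Lemma sum_powerset_prod (A : comPzRingType) (I : finType) (E : {set I})
    (f g : I -> A) :
  \sum_(G in powerset E) \prod_(e in E) (if e \in G then f e else g e)
    = \prod_(e in E) (f e + g e).
Proof.
pose f' e := if e \in E then f e else 0.
pose g' e := if e \in E then g e else 1.
rewrite [RHS]big_mkcond (eq_bigr (fun e => f' e + g' e)) => [|e _]; last first.
  by rewrite /f' /g'; case: ifP; rewrite // add0r.
rewrite bigA_distr [RHS](bigID (fun G : {set I} => G \subset E)) /=.
rewrite [X in _ + X]big1 ?addr0 => [|G nGE].
  apply: eq_big => [G|G]; rewrite ?powersetE // => GE.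
  rewrite [LHS]big_mkcond; apply: eq_bigr => e _; rewrite /f' /g'.
  by case: (boolP (e \in E)) => // eE; case: ifP => // /(subsetP GE); rewrite (negPf eE).
case/subsetPn: nGE => e eG eE.
by rewrite (bigD1 e) //= eG /f' (negPf eE) mul0r.
Qed.

Definition Gnp_weight (R : realType) (T : finType) (p : R) (G : {set {set T}}) :=
  \prod_(e in complete_graph T) (if e \in G then p else 1 - p).

Lemma Gnp_weight_ge0 (R : realType) (T : finType) (p : R) (G : {set {set T}}) :
  0 <= p <= 1 -> 0 <= Gnp_weight p G.
Proof.
by move=> /andP[p0 p1]; apply: prodr_ge0 => e _; case: ifP; rewrite ?subr_ge0.
Qed.

(** The sum factors over the edges: those in H contribute p, and each of the
    others contributes [p + (1 - p)]. *)
Lemma sum_Gnp_weight_supset (R : realType) (T : finType) (p : R)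
    (H : {set {set T}}) :
    H \subset complete_graph T ->
  \sum_(G in powerset (complete_graph T) | H \subset G) Gnp_weight p G
    = p ^+ #|H|.
Proof.
move=> HK; set K := complete_graph T.
transitivity (\sum_(G in powerset K)
    \prod_(e in K) (if e \in G then p else if e \in H then 0 else 1 - p)).
  rewrite big_mkcondr; apply: eq_bigr => G GK; case: ifP => HG.
    apply: eq_bigr => e _; case: ifP => // eG; case: ifP => // /(subsetP HG).
    by rewrite eG.
  case/negbT/subsetPn: HG => e eH eG.
  by rewrite (bigD1 e) ?(subsetP HK) //= (negPf eG) eH mul0r.
rewrite sum_powerset_prod (eq_bigr (fun e => if e \in H then p else 1)); last first.
  by move=> e _; case: ifP; rewrite ?addr0 // addrC subrK.
rewrite -big_mkcondr -prodr_const; apply: eq_bigl => e.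
by rewrite andbC; case: (boolP (e \in H)) => // /(subsetP HK)->.
Qed.

Lemma Gnp_prob_compl (R : realType) n (p : R) (P : {set {set 'I_n}} -> Prop) :
  Gnp_prob p P + Gnp_prob p (fun G => ~ P G) = 1.
Proof.
have := sum_Gnp_weight_supset p (sub0set (complete_graph 'I_n)).
rewrite cards0 expr0 => <-.
under [RHS]eq_bigl do rewrite sub0set andbT.
rewrite [RHS](bigID (fun G => `[< P G >])) /=; congr (_ + _).
by apply: eq_bigl => G; rewrite asbool_neg.
Qed.

Lemma Gnp_prob_ge0 (R : realType) n (p : R) (P : {set {set 'I_n}} -> Prop) :
  0 <= p <= 1 -> 0 <= Gnp_prob p P.
Proof. by move=> p01; apply: sumr_ge0 => G _; exact: Gnp_weight_ge0. Qed.

Lemma Gnp_union_bound (R : realType) n (p : R) (P : {set {set 'I_n}} -> Prop)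
    (I : finType) (J : pred I) (H : I -> {set {set 'I_n}}) :
    0 <= p <= 1 ->
    (forall i, J i -> H i \subset complete_graph 'I_n) ->
    (forall G : {set {set 'I_n}}, G \subset complete_graph 'I_n -> P G ->
       exists2 i, J i & H i \subset G) ->
  Gnp_prob p P <= \sum_(i | J i) p ^+ #|H i|.
Proof.
move=> p01 HK PJ.
under eq_bigr => i Ji do rewrite -(sum_Gnp_weight_supset p (HK i Ji)) big_mkcondr /=.
rewrite exchange_big /= /Gnp_prob big_mkcondr; apply: ler_sum => G.
have w0 := @Gnp_weight_ge0 _ _ p G p01.
rewrite powersetE => GK; case: asboolP => [PG|_]; last first.
  by apply: sumr_ge0 => i _; case: ifP.
have [i Ji HG] := PJ G GK PG.
rewrite (bigD1 i) //= HG lerDl; apply: sumr_ge0 => j _; by case: ifP.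
Qed.

Lemma not_sparseP (T : finType) k L (R : {set T}) (G : {set {set T}}) :
    ~ sparse k L R G ->
  exists2 U : {set T}, (#|U| <= L)%N
    & (3 * k * #|U :\: R| < (2 * k).+1 * #|edges_in G U|)%N.
Proof.
move=> nsp; apply: contrapT => none; apply: nsp => U leU; rewrite leqNgt.
by apply/negP=> lt; apply: none; exists U.
Qed.

Lemma Gnp_not_sparse (R : realType) n (p : R) k L (S : {set 'I_n}) :
    0 <= p <= 1 ->
  Gnp_prob p (fun G => ~ sparse k L S G) <=
    \sum_(UH : {set 'I_n} * {set {set 'I_n}} |
       [&& #|UH.1| <= L, UH.2 \subset complete_graph 'I_n,
           UH.2 \subset powerset UH.1
         & 3 * k * #|UH.1 :\: S| < (2 * k).+1 * #|UH.2|]%N) p ^+ #|UH.2|.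
Proof.
move=> p01; apply: Gnp_union_bound => // [[U H] /= /and4P[]//|G GK].
move=> /not_sparseP[U leU ltU]; exists (U, edges_in G U) => /=; last first.
  by apply/subsetP=> e; rewrite inE => /andP[].
rewrite leU ltU andbT /=; apply/andP; split.
  by apply/subsetP=> e; rewrite inE => /andP[/(subsetP GK)].
by apply/subsetP=> e; rewrite !inE => /andP[].
Qed.

(* Imported only here: the lemmas on classical sets share their names with those
   on finite sets. *)
From mathcomp Require Import all_classical all_reals all_analysis lra.
Import numFieldNormedType.Exports.
Local Open Scope classical_set_scope.

(** The hypothesis on w and m is strict between integers, which yields
    [(2/3 + d) m >= w + d] for [d = 1/(3k) <= eps]; the extra d on the right is
    the decay. *)
Lemma edge_power_le (R : realType) (eps p : R) (n k w m : nat) :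
    (0 < n)%N -> (0 < k)%N -> 0 <= p -> p <= n%:R `^ (- (2 / 3) - eps) ->
    (3 * k)%:R^-1 <= eps -> (3 * k * w < (2 * k).+1 * m)%N ->
  p ^+ m <= n%:R `^ (- (3 * k)%:R^-1) * n%:R^-1 ^+ w.
Proof.
move=> n0 k0 p0 ple ke lt.
have n1 : 1 <= n%:R :> R by rewrite ler1n.
have nn0 : 0 <= n%:R :> R by rewrite ler0n.
apply: le_trans (_ : (n%:R `^ (- (2 / 3) - eps)) ^+ m <= _).
  by apply: lerXn2r; rewrite // nnegrE powR_ge0.
rewrite -(powR_inv1 nn0) -!powR_mulrn ?powR_ge0 // -!powRrM -powRD; last first.
  by apply/implyP=> _; rewrite pnatr_eq0 -lt0n.
apply: ler_powR => //.
have K0 : 0 < (3 * k)%:R :> R by rewrite ltr0n muln_gt0.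
have h : 3 * k%:R * w%:R + 1 <= (2 * k%:R + 1) * m%:R :> R.
  have <- : (3 * k * w + 1)%:R = 3 * k%:R * w%:R + 1 :> R by rewrite natrD !natrM.
  have <- : ((2 * k + 1) * m)%:R = (2 * k%:R + 1) * m%:R :> R.
    by rewrite natrM natrD natrM.
  by rewrite ler_nat !addn1.
set d := (3 * k)%:R^-1 in ke *.
have dk : d * k%:R = 3^-1.
  by rewrite /d natrM invfM -mulrA mulVf ?mulr1 // pnatr_eq0 -lt0n.
have d0 : 0 <= d by rewrite invr_ge0 ltW.
have {}h := ler_wpM2l d0 h.
have m0 : 0 <= m%:R :> R by rewrite ler0n.
have := ler_wpM2r m0 ke.
have e1 : d * (3 * k%:R * w%:R + 1) = w%:R + d.
  rewrite mulrDr mulr1 !mulrA (mulrC d 3) -(mulrA 3 d) dk; lra.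
have e2 : d * ((2 * k%:R + 1) * m%:R) = 2 / 3 * m%:R + d * m%:R.
  rewrite !mulrA mulrDr mulr1 mulrDl (mulrC 2) !mulrA dk; lra.
rewrite e1 e2 in h.
by lra.
Qed.

(** The sum factors over the vertices into [2] for each vertex of S and
    [1 + 1/n <= expR (1/n)] for each of the others. *)
Lemma sum_vertex_sets (R : realType) n (S : {set 'I_n}) :
  \sum_(U : {set 'I_n}) n%:R^-1 ^+ #|U :\: S| <= 2 ^+ #|S| * expR 1 :> R.
Proof.
pose y x : R := if x \in S then 1 else n%:R^-1.
have y0 x : 0 <= y x by rewrite /y; case: ifP; rewrite ?invr_ge0 ?ler0n ?ler01.
rewrite (eq_bigr (fun U : {set 'I_n} => \prod_x (if x \in U then y x else 1))).
  rewrite -bigA_distr.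
  rewrite (bigID (mem S)) /=; apply: ler_pM.
  - by apply: prodr_ge0 => x _; rewrite addr_ge0.
  - by apply: prodr_ge0 => x _; rewrite addr_ge0.
  - rewrite -prodr_const le_eqVlt; apply/orP; left; apply/eqP.
    by apply: eq_bigr => x xS; rewrite /y xS.
  apply: le_trans (_ : \prod_(x : 'I_n) expR (n%:R^-1 : R) <= _).
    rewrite [leRHS](bigID (mem S)) /= -[leLHS]mul1r; apply: ler_pM => //.
    - by apply: prodr_ge0 => x _; rewrite addr_ge0.
    - apply: (big_ind (fun z => 1 <= z)) => // [z t|x _]; first exact: mulr_ege1.
      by apply: le_trans (expR_ge1Dx _); rewrite lerDl invr_ge0 ler0n.
    apply: ler_prod => x xS; rewrite addr_ge0 //= /y (negPf xS) addrC.
    exact: expR_ge1Dx.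
  rewrite prodr_const card_ord -expRM_natl ler_expR.
  case: n {S y y0} => [|n]; first by rewrite mul0r ler01.
  by rewrite mulfV // pnatr_eq0.
move=> U _; rewrite -big_mkcond /= (bigID (mem S)) /= big1 ?mul1r => [|x]; last first.
  by move=> /andP[_ xS]; rewrite /y xS.
rewrite -prodr_const; apply: eq_big => [x|x]; first by rewrite inE andbC.
by rewrite inE /y => /andP[/negPf->].
Qed.

(** The factor [2 ^ 2 ^ L] bounds the number of sets of edges H inside a given
    set U of at most L vertices. *)
Lemma Gnp_not_sparse_le (R : realType) (eps p : R) (n k L : nat) (S : {set 'I_n}) :
    (0 < n)%N -> (0 < k)%N -> 0 <= p <= 1 ->
    p <= n%:R `^ (- (2 / 3) - eps) -> (3 * k)%:R^-1 <= eps ->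
  Gnp_prob p (fun G => ~ sparse k L S G) <=
    (2 ^ 2 ^ L)%:R * (2 ^+ #|S| * expR 1) * n%:R `^ (- (3 * k)%:R^-1).
Proof.
move=> n0 k0 p01 ple ke; apply: le_trans (Gnp_not_sparse _ _ _ p01) _.
have p0 : 0 <= p by case/andP: p01.
set a := n%:R `^ _; have a0 : 0 <= a by exact: powR_ge0.
apply: le_trans (_ : \sum_(UH : {set 'I_n} * {set {set 'I_n}} |
    (#|UH.1| <= L)%N && (UH.2 \subset powerset UH.1))
    a * n%:R^-1 ^+ #|UH.1 :\: S| <= _).
  rewrite big_mkcond [leRHS]big_mkcond; apply: ler_sum => -[U H] _ /=.
  case: (#|U| <= L)%N => //=; case: (H \subset powerset U); rewrite ?andbF //=.
  have pos : 0 <= a * n%:R^-1 ^+ #|U :\: S|.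
    by rewrite mulr_ge0 // exprn_ge0 // invr_ge0 ler0n.
  by case: (H \subset _) => //=; case: ifP => // lt; exact: edge_power_le ple _ _.
rewrite -(pair_big_dep (fun U : {set 'I_n} => #|U| <= L)%N
  (fun (U : {set 'I_n}) (H : {set {set 'I_n}}) => H \subset powerset U)
  (fun U _ => a * n%:R^-1 ^+ #|U :\: S|)) /=.
apply: le_trans (_ : \sum_(U : {set 'I_n})
    (2 ^ 2 ^ L)%:R * (a * n%:R^-1 ^+ #|U :\: S|) <= _).
  rewrite big_mkcond; apply: ler_sum => U _.
  have pos : 0 <= a * n%:R^-1 ^+ #|U :\: S|.
    by rewrite mulr_ge0 // exprn_ge0 // invr_ge0 ler0n.
  case: ifP => [leU|_]; last by rewrite mulr_ge0 // ler0n.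
  rewrite (eq_bigl (mem (powerset (powerset U)))) => [|H]; last by rewrite !inE.
  rewrite sumr_const !card_powerset -[leLHS]mulr_natl ler_wpM2r //.
  by rewrite ler_nat !leq_exp2l.
rewrite -!mulr_sumr -mulrA ler_wpM2l ?ler0n // mulrC ler_wpM2r //.
exact: sum_vertex_sets.
Qed.

(** * The threshold *)

Lemma powR_decay (R : realType) (C d e : R) :
    0 < C -> 0 < d -> 0 < e ->
  \forall n \near \oo, C * n%:R `^ (- d) <= e.
Proof.
move=> C0 d0 e0; pose x := (C / e) `^ d^-1.
exists (Num.bound x) => // n /= len.
have xn : x <= n%:R.
  by apply/ltW/(lt_le_trans (archi_boundP (powR_ge0 _ _))); rewrite ler_nat.
have Ce0 : 0 < C / e by rewrite divr_gt0.
have xd : x `^ d = C / e.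
  by rewrite /x -powRrM mulVf ?gt_eqF // powRr1 // ltW.
have := ge0_ler_powR (ltW d0) (powR_ge0 _ _ : x \in Num.nneg)
  (ler0n _ n : _ \in Num.nneg) xn.
rewrite xd => le.
have pos : 0 < n%:R `^ d :> R by exact: lt_le_trans le.
by rewrite powRN ler_pdivrMr // mulrC -ler_pdivrMr.
Qed.

Lemma sparse_breaker_can_isolate (T : finType) k L (S : {set T})
    (G : {set {set T}}) :
    sparse k L S G -> G \subset complete_graph T ->
    (4 + (12 * k).+1 * k.+1 <= L)%N -> (12 * k + 4 < #|S|)%N ->
  breaker_can_isolate 2 2 G.
Proof.
move=> spG GK leL ltS; apply: (breaker_can_isolate_guards GK) => K leK.
exact: (exists_far_guard spG leL GK ltS leK).
Qed.

Theorem theorem1p4 (R : realType) (eps : R) (eps_gt0 : 0 < eps)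
    (p : nat -> R) (p01 : forall n : nat, 0 <= p n <= 1)
    (p_le : forall n : nat, (0 < n)%N -> p n <= n%:R `^ (- (2 / 3) - eps)) :
  (fun n : nat => Gnp_prob (p n)
     (fun G : {set {set 'I_n}} => breaker_can_isolate 2 2 G)) @ \oo --> (1 : R).
Proof.
pose k := (Num.bound eps^-1).+1.
have ke : (3 * k)%:R^-1 <= eps.
  rewrite -[leRHS]invrK lef_pV2 ?posrE ?invr_gt0 ?ltr0n ?muln_gt0 //.
  apply/ltW/(lt_le_trans (archi_boundP _)); first by rewrite invr_ge0 ltW.
  by rewrite ler_nat /k; apply: leq_trans (leqnSn _) (leq_pmull _ _).
(* Enough roots, and room for the sets built in the search for a far root. *)
pose M := (12 * k + 5)%N; pose L := (4 + (12 * k).+1 * k.+1)%N.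
pose C : R := (2 ^ 2 ^ L)%:R * (2 ^+ M * expR 1).
have C0 : 0 < C.
  apply: mulr_gt0; first by rewrite ltr0n !expn_gt0.
  by apply: mulr_gt0; [apply: exprn_gt0; rewrite ltr0n | exact: expR_gt0].
apply/cvgrPdist_le => e e0.
have d0 : 0 < (3 * k)%:R^-1 :> R by rewrite invr_gt0 ltr0n.
have small := powR_decay C0 d0 e0.
near=> n.
have Mn : (M <= n)%N by near: n; exact: nbhs_infty_ge.
have len : C * n%:R `^ (- (3 * k)%:R^-1) <= e by near: n.
pose S : {set 'I_n} := [set widen_ord Mn i | i : 'I_M].
have cS : #|S| = M.
  by rewrite card_imset ?card_ord // => i j /(congr1 val) /= ij; apply: val_inj.
have n0 : (0 < n)%N by apply: (leq_trans _ Mn); rewrite /M addnS.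
set P := fun G => _.
have compl := Gnp_prob_compl (p n) P.
rewrite -compl addrC addKr ger0_norm ?Gnp_prob_ge0 //.
have ple := Gnp_not_sparse_le L S n0 (ltn0Sn _) (p01 n) (p_le n n0) ke.
apply: le_trans (_ : _ <= C * n%:R `^ (- (3 * k)%:R^-1)) _; last exact: len.
apply: le_trans (_ : _ <= Gnp_prob (p n) (fun G => ~ sparse k L S G)) _; last first.
  by apply: le_trans ple _; rewrite cS.
rewrite /Gnp_prob big_mkcondr [leRHS]big_mkcondr; apply: ler_sum => G.
rewrite powersetE => GK.
have w0 := Gnp_weight_ge0 G (p01 n).
case: asboolP => [nP|_]; last by case: ifP.
case: asboolP => // sp; case: nP; rewrite /P.
have spG : sparse k L S G by apply: contrapT.
apply: (sparse_breaker_can_isolate spG GK); first exact: leqnn.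
by rewrite cS ltn_add2l.
Unshelve. all: by end_near.
Qed.
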